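(* Let $z_1\neq z_2$ and $z$ be points of $\Omega$, let $\mu,\lambda\in\mathbb{C}$, let $s,t$ be positive real numbers, and put $$A_s=\begin{pmatrix}z_1&0\\ s\mu(z_1-z_2)&z_2\end{pmatrix},\qquad B_t=\begin{pmatrix}z&0\\ t\lambda&z\end{pmatrix}.$$ (1) The homomorphism $\rho_{A_s}$ is contractive if and only if $s^2=s_\Omega(z_1,z_2)^{-1}-1$ and $|\mu|\le1$. (2) Similarly, the homomorphism $\rho_{B_t}$ is contractive if and only if $t=t_\Omega(z)^{-1}$ and $|\lambda|\le1$.
   Context: $\Omega\subseteq\mathbb{C}$ is a finitely connected bounded domain whose boundary is the disjoint union of simple analytic closed curves. $\mathrm{Rat}(\Omega)$ is the algebra of rational functions with poles off $\overline{\Omega}$, with norm $\|r\|=\sup\{|r(w)|:w\in\Omega\}$. For a $2\times2$ matrix $A$ with eigenvalues in $\Omega$, $\rho_A:\mathrm{Rat}(\Omega)\to\mathcal{M}_2$ is the unital homomorphism $r\mapsto r(A)$, where $\mathcal{M}_2$ is the algebra of $2\times 2$ complex matrices with the operator norm on $\mathbb{C}^2$; $\rho_A$ is contractive if $\|r(A)\|\le\|r\|$ for all $r\in\mathrm{Rat}(\Omega)$. The extremal quantities are $$s_\Omega(z_1,z_2)=\sup\{|r(z_1)|^2: r\in\mathrm{Rat}(\Omega),\ \|r\|\le1,\ r(z_2)=0\},$$ $$t_\Omega(z)=\sup\{|r'(z)|: r\in\mathrm{Rat}(\Omega),\ \|r\|\le1,\ r(z)=0\}.$$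
   Formalization: As printed it fails for μ=0 or λ=0 (contractive for all s, t). Proved instead, for each s,t>0: [for all μ, ρ_{A_s} is contractive iff |μ|≤1] iff s²=s_Ω(z1,z2)^{-1}−1; and [for all λ, ρ_{B_t} is contractive iff |λ|≤1] iff t=t_Ω(z)^{-1}. *)

(* Defs.v *)
(* MathComp / MathComp-Analysis; the complex plane is R[i] for R : realType. *)
From HB Require Import structures.
From mathcomp Require Import all_boot all_order all_algebra.
From mathcomp Require Import all_classical all_reals all_analysis.
From mathcomp Require Import complex.

Set Implicit Arguments.
Unset Strict Implicit.
Unset Printing Implicit Defensive.

Import Order.TTheory GRing.Theory Num.Theory.
Import numFieldNormedType.Exports.
Import ComplexField.Normc.

Local Open Scope classical_set_scope.
Local Open Scope ring_scope.
Local Open Scope complex_scope.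

(* The usual topology and norm of the complex plane live on the copy R[i]^o of
   R[i]; [normc] is the modulus with values in R, whereas `|w| has values
   in R[i]. *)
Section Domains.
Variable R : realType.
Implicit Types (Omega K : set R[i]^o).

Definition unit_circle : set R[i]^o := [set w | normc w = 1].

(* Image of the unit circle under a map that is holomorphic and injective near
   the circle. *)
Definition simple_analytic_closed_curve K : Prop :=
  exists (U : set R[i]^o) (f : R[i]^o -> R[i]^o),
    [/\ open U /\ unit_circle `<=` U,
        forall w, U w -> derivable f w 1,
        {in U &, injective f} &
        K = f @` unit_circle].

(* For bounded Omega, the component of the complement containing infinity in
   the Riemann sphere meets the plane in exactly one component, so components
   can be counted in the plane. *)
Definition finitely_connected Omega : Prop :=
  finite_set [set connected_component (~` Omega) w | w in ~` Omega].

Definition analytic_boundary Omega : Prop :=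
  exists Gamma : set (set R[i]^o),
    [/\ forall K, Gamma K -> simple_analytic_closed_curve K,
        trivIset Gamma id &
        closure Omega `\` interior Omega = \bigcup_(K in Gamma) K].

Definition analytic_domain Omega : Prop :=
  [/\ open Omega /\ Omega !=set0, connected Omega, bounded_set Omega,
      finitely_connected Omega & analytic_boundary Omega].

End Domains.

Section Rational.
Variables (R : realType) (Omega : set R[i]^o).

(* A rational function presented as a quotient of polynomials.  It may have
   several presentations; everything below depends only on its values. *)
Record Rat := MkRat {
  num : {poly R[i]};
  den : {poly R[i]};
  den_neq0 : forall w, closure Omega w -> den.[w] != 0 }.

Definition rat_eval (r : Rat) (w : R[i]) : R[i]^o := (num r).[w] / (den r).[w].

Definition rat_norm (r : Rat) : R := sup [set normc (rat_eval r w) | w in Omega].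

(* The functional calculus r |-> r(A); meaningful when the eigenvalues of A lie
   in Omega, since the matrix [horner_mx A (den r)] is then invertible. *)
Definition rho (A : 'M[R[i]]_2) (r : Rat) : 'M[R[i]]_2 :=
  horner_mx A (num r) / horner_mx A (den r).

Definition l2norm (n : nat) (v : 'cV[R[i]]_n) : R :=
  Num.sqrt (\sum_(i < n) normc (v i ord0) ^+ 2).

Definition opnorm (A : 'M[R[i]]_2) : R :=
  sup [set l2norm (A *m v) | v in [set v : 'cV_2 | l2norm v <= 1]].

Definition contractive (phi : Rat -> 'M[R[i]]_2) : Prop :=
  forall r : Rat, opnorm (phi r) <= rat_norm r.

Definition s_ext (z1 z2 : R[i]) : R :=
  sup [set normc (rat_eval r z1) ^+ 2 |
       r in [set r : Rat | rat_norm r <= 1 /\ rat_eval r z2 = 0]].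

Definition t_ext (z : R[i]) : R :=
  sup [set normc (derive1 (rat_eval r) z) |
       r in [set r : Rat | rat_norm r <= 1 /\ rat_eval r z = 0]].

End Rational.

Arguments rho {R} Omega A r.

Section Matrices.
Variable R : realType.

Definition mx2 (a b c d : R[i]) : 'M[R[i]]_2 :=
  \matrix_(i < 2, j < 2)
    if i == ord0 then (if j == ord0 then a else b)
    else (if j == ord0 then c else d).

Definition matA (z1 z2 mu : R[i]) (s : R) : 'M[R[i]]_2 :=
  mx2 z1 0 (s%:C * mu * (z1 - z2)) z2.

Definition matB (z lambda : R[i]) (t : R) : 'M[R[i]]_2 :=
  mx2 z 0 (t%:C * lambda) z.

End Matrices.

(* Main.v *)
Require Import Defs.
From mathcomp Require Import all_boot all_order all_algebra.
From mathcomp Require Import all_classical all_reals all_analysis.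
From mathcomp Require Import complex.
From mathcomp Require Import ring.
Import Order.TTheory GRing.Theory Num.Theory.
Import numFieldNormedType.Exports.
Import ComplexField.Normc.
Local Open Scope classical_set_scope.
Local Open Scope ring_scope.
Local Open Scope complex_scope.

(** Both parts reduce contractivity to the rational functions that vanish at one
point.  If r has norm less than 1 and b = r(w0) with w0 in Omega, then
g = (r - b) / (1 - b^* r) is again a rational function without poles on the
closure of Omega, has norm at most 1 and vanishes at w0.  When g(A) is a
contraction, so is r(A): the identity
  |d - b^* n|^2 - |n - b d|^2 = (1 - |b|^2) (|d|^2 - |n|^2),
valid for complex numbers and for vectors, shows that a Moebius map of the disc
preserves contractions as well as the disc itself.  A rescaling by a factor
slightly larger than the norm of r gives the general case.  This is
[contractive_vanishing].

If r(z2) = 0, the matrix r(A_s) has the single nonzero column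
(r(z1), s mu r(z1)); if r(z) = 0, then r(B_t) has the single nonzero entry
t lambda r'(z).  The norm of such a matrix is the Euclidean norm of its column,
so that contractivity means |r(z1)|^2 (1 + (s |mu|)^2) <= 1, respectively
t |lambda| |r'(z)| <= 1, for all r of norm at most 1 vanishing at the point
([contractive_matA], [contractive_matB]).  Taking suprema, these conditions read
s |mu| <= K^(1/2) with K = s_Omega(z1, z2)^-1 - 1, and t |lambda| <= t_Omega(z)^-1.
Such a condition describes exactly the closed unit disc of parameters if and
only if the scale s, respectively t, equals the bound ([scale_threshold]).

The function (w - a) / C shows that both suprema are positive.  The first one is
at most 1.  If the set of values |r'(z)| in the second one were unbounded, both
sides of the equivalence would fail: the [sup] would be 0 by convention, and
t > 0 would differ from 0^-1 = 0, while contractivity for lambda = 1 would bound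
this set by 1 / t. *)

Set Implicit Arguments.
Unset Strict Implicit.

(** * The modulus of a complex number *)

Lemma normc_ge0 (R : rcfType) (x : R[i]) : 0 <= normc x.
Proof. by case: x => a b; exact: sqrtr_ge0. Qed.

Lemma sqr_normcE (R : rcfType) (x : R[i]) :
  normc x ^+ 2 = complex.Re x ^+ 2 + complex.Im x ^+ 2.
Proof. by case: x => a b; rewrite sqr_sqrtr// addr_ge0 ?sqr_ge0. Qed.

Lemma normc_eq0 (R : rcfType) (x : R[i]) : (normc x == 0) = (x == 0).
Proof. by apply/eqP/eqP => [/eq0_normc|->] //; rewrite normc0. Qed.

Lemma normc_gt0 (R : rcfType) (x : R[i]) : (0 < normc x) = (x != 0).
Proof. by rewrite lt_neqAle eq_sym normc_eq0 normc_ge0 andbT. Qed.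

Lemma normc_real (R : rcfType) (x : R) : normc x%:C = `|x|.
Proof. by rewrite /normc /= expr0n /= addr0 sqrtr_sqr. Qed.

Lemma normc_conj (R : rcfType) (x : R[i]) : normc x^* = normc x.
Proof. by case: x => a b; rewrite /= sqrrN. Qed.

Lemma lerB_normc (R : rcfType) (x y : R[i]) :
  normc x - normc y <= normc (x - y).
Proof.
by rewrite lerBlDr -[in leLHS](subrK y x); exact: le_normcD.
Qed.

Lemma normc_sum_le (R : rcfType) (I : finType) (F : I -> R[i]) :
  normc (\sum_i F i) <= \sum_i normc (F i).
Proof.
elim/big_rec2: _ => [|i y x _ H]; first by rewrite normc0.
by rewrite (le_trans (le_normcD _ _))// lerD2l.
Qed.

(** * Polynomials on a bounded set and on its closure *)

Lemma continuous_horner_complex (R : realType) (p : {poly R[i]}) :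
  continuous (fun w : R[i]^o => p.[w] : R[i]^o).
Proof.
elim/poly_ind: p => [|p c IH] w.
  rewrite (_ : (fun _ => _) = cst 0); last by apply/funext => x; rewrite horner0.
  exact: cst_continuous.
have -> : (fun x => (p * 'X + c%:P).[x] : R[i]^o) =
    ((fun x => p.[x] : R[i]^o) \* id : R[i]^o -> R[i]^o) + cst (c : R[i]^o).
  by apply/funext => x; rewrite hornerMXaddC.
apply: continuousD; last exact: cst_continuous.
by apply: (@continuousM R[i] R[i]^o); [exact: IH|exact: cvg_id].
Qed.

Lemma bounded_horner (R : realType) (Omega : set R[i]^o) (p : {poly R[i]}) :
  bounded_set Omega -> exists M, forall w, Omega w -> normc p.[w] <= M.
Proof.
move=> [B [/RRe_real<- HB]].
have [B' HB'] : exists B' : R, forall w, Omega w -> normc w <= B'.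
  exists (complex.Re B + 1) => w Hw.
  by rewrite -lecR; apply: HB (Hw); rewrite ltcR ltrDl.
elim/poly_ind: p => [|p c [M HM]].
  by exists 0 => w _; rewrite horner0 normc0.
exists (M * B' + normc c) => w Hw.
rewrite hornerMXaddC (le_trans (le_normcD _ _))// lerD2r normcM.
by rewrite ler_pM ?normc_ge0//; [exact: HM|exact: HB'].
Qed.

Lemma not_closure_dist (R : realType) (Omega : set R[i]^o) (a : R[i]) :
  ~ closure Omega a ->
  exists2 d : R, 0 < d & forall w, Omega w -> d <= normc (w - a).
Proof.
move/existsNP => [B /not_implyP[]]; move/nbhs_ballP => [e /= e0 HB] BO.
have er : e = (complex.Re e)%:C.
  by move: e0; case: (e) => x y; rewrite ltcE /= => /andP[/eqP->].
exists (complex.Re e); first by rewrite er ltcR in e0.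
move=> w Hw; rewrite leNgt; apply/negP => H; apply: BO; exists w; split => //.
apply: HB; rewrite -ball_normE /= er -[_ < _]/(((normc (a - w))%:C < _)) ltcR.
by rewrite -normcN opprB.
Qed.

(** A root lying off the closure of Omega keeps a positive distance from Omega;
the product of these distances, over the factors of the polynomial, is a lower
bound. *)
Lemma horner_bounded_below (R : realType) (Omega : set R[i]^o)
    (p : {poly R[i]}) :
  (forall w, closure Omega w -> p.[w] != 0) ->
  exists2 d : R, 0 < d & forall w, Omega w -> d <= normc p.[w].
Proof.
move=> p_neq0; have [rs Ep] := closed_field_poly_normal p.
have [p0|lp0] := eqVneq (lead_coef p) 0.
  exists 1 => // w /subset_closure/p_neq0.
  by rewrite Ep p0 scale0r horner0 eqxx.
have {p_neq0} : forall a, a \in rs -> ~ closure Omega a.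
  move=> a ars /p_neq0/negP; apply; rewrite Ep hornerZ mulf_eq0.
  by apply/orP; right; rewrite -/(root _ a) root_prod_XsubC.
rewrite Ep; elim: rs {Ep} => [|a rs IH] Hrs.
  exists (normc (lead_coef p)); first by rewrite normc_gt0.
  by move=> w _; rewrite big_nil hornerZ hornerC mulr1.
have [|d d0 Hd] := IH; first by move=> b Hb; apply: Hrs; rewrite inE Hb orbT.
have [|e e0 He] := @not_closure_dist _ Omega a.
  by apply: Hrs; rewrite mem_head.
exists (e * d); first exact: mulr_gt0.
move=> w Hw; rewrite big_cons scalerAr hornerM hornerXsubC normcM.
by rewrite ler_pM ?(ltW e0) ?(ltW d0) ?He ?Hd.
Qed.

(** The converse of [horner_bounded_below]: it certifies that a denominator
built from values on Omega alone has no zero on the boundary. *)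
Lemma horner_neq0_closure (R : realType) (Omega : set R[i]^o)
    (p : {poly R[i]}) (d : R) :
  0 < d -> (forall w, Omega w -> d <= normc p.[w]) ->
  forall w, closure Omega w -> p.[w] != 0.
Proof.
move=> d0 Hd w clw; apply/eqP => pw0.
have /clw[v [Hv]] : nbhs w [set v : R[i]^o | `|p.[v] : R[i]^o| < d%:C].
  have /cvgrPdist_lt /(_ d%:C) := @continuous_horner_complex R p w.
  rewrite ltcR => /(_ d0); apply: filterS => v.
  by rewrite pw0 sub0r normrN.
by rewrite /= -[_ < _]/((normc p.[v])%:C < d%:C) ltcR ltNge Hd.
Qed.

(** * The supremum norm of rational functions *)

Section BoundedDomain.
Variables (R : realType) (Omega : set R[i]^o).
Hypotheses (Omega0 : Omega !=set0) (Omegab : bounded_set Omega).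

(** Since [sup] of an unbounded set is 0, the norm of a rational function is
meaningful only thanks to this bound. *)
Lemma rat_eval_bounded (r : Defs.Rat Omega) :
  has_ubound [set normc (rat_eval r w) | w in Omega].
Proof.
have [d d0 Hd] := horner_bounded_below (@den_neq0 _ _ r).
have [M HM] := bounded_horner (Defs.num r) Omegab.
exists (M * d^-1) => _ [w Hw <-].
rewrite /rat_eval normcM normcV ler_pM ?invr_ge0 ?normc_ge0//; first exact: HM.
by rewrite lef_pV2 ?posrE// ?Hd// (lt_le_trans d0)// Hd.
Qed.

Lemma normc_rat_eval_le (r : Defs.Rat Omega) w :
  Omega w -> normc (rat_eval r w) <= rat_norm r.
Proof. by move=> Hw; apply: ub_le_sup; [exact: rat_eval_bounded|exists w]. Qed.

Lemma rat_norm_le (r : Defs.Rat Omega) (M : R) :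
  rat_norm r <= M <-> forall w, Omega w -> normc (rat_eval r w) <= M.
Proof.
split=> [rM w Hw|H]; first exact: le_trans (normc_rat_eval_le r Hw) rM.
apply: ge_sup; first by case: Omega0 => w Hw; exists (normc (rat_eval r w)), w.
by move=> _ [w Hw <-]; exact: H.
Qed.

End BoundedDomain.

(** * The operator norm *)

Lemma l2norm_ge0 (R : realType) n (v : 'cV[R[i]]_n) : 0 <= l2norm v.
Proof. exact: sqrtr_ge0. Qed.

Lemma sqr_l2norm (R : realType) n (v : 'cV[R[i]]_n) :
  l2norm v ^+ 2 = \sum_(i < n) normc (v i ord0) ^+ 2.
Proof. by rewrite sqr_sqrtr// sumr_ge0// => i _; exact: sqr_ge0. Qed.

Lemma l2normZ (R : realType) n (a : R[i]) (v : 'cV[R[i]]_n) :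
  l2norm (a *: v) = normc a * l2norm v.
Proof.
apply/eqP; rewrite -(eqrXn2 (n := 2))// ?mulr_ge0 ?l2norm_ge0 ?normc_ge0//.
rewrite exprMn !sqr_l2norm mulr_sumr; apply/eqP/eq_bigr => i _.
by rewrite mxE normcM exprMn.
Qed.

Lemma l2norm_eq0 (R : realType) n (v : 'cV[R[i]]_n) : l2norm v = 0 -> v = 0.
Proof.
move/eqP; rewrite -sqrf_eq0 sqr_l2norm psumr_eq0; last by move=> *; exact: sqr_ge0.
move/allP => H; apply/matrixP => i j; rewrite (ord1 j) mxE.
have := H i (mem_index_enum i); rewrite /= sqrf_eq0 normc_eq0.
by move/eqP.
Qed.

Lemma normc_le_l2norm (R : realType) n (v : 'cV[R[i]]_n) i :
  normc (v i ord0) <= l2norm v.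
Proof.
rewrite -(ler_pXn2r (n := 2)) ?nnegrE ?l2norm_ge0 ?normc_ge0// sqr_l2norm.
by rewrite (bigD1 i)//= lerDl sumr_ge0// => *; exact: sqr_ge0.
Qed.

Lemma l2norm_le_sum (R : realType) n (v : 'cV[R[i]]_n) :
  l2norm v <= \sum_i normc (v i ord0).
Proof.
rewrite -(ler_pXn2r (n := 2)) ?nnegrE ?l2norm_ge0 ?sumr_ge0//; last first.
  by move=> *; exact: normc_ge0.
rewrite sqr_l2norm.
rewrite [leRHS]expr2 mulr_suml ler_sum// => i _; rewrite expr2.
rewrite ler_wpM2l ?normc_ge0// (bigD1 i)//= lerDl sumr_ge0// => *.
exact: normc_ge0.
Qed.

Lemma opnorm_set_bounded (R : realType) (A : 'M[R[i]]_2) :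
  has_ubound [set l2norm (A *m v) | v in [set v : 'cV_2 | l2norm v <= 1]].
Proof.
exists (\sum_i \sum_j normc (A i j)) => _ [v /= v1 <-].
rewrite (le_trans (l2norm_le_sum _))// ler_sum// => i _.
rewrite mxE (le_trans (normc_sum_le _))// ler_sum// => j _.
rewrite normcM ler_piMr ?normc_ge0//.
exact: le_trans (normc_le_l2norm v j) v1.
Qed.

(** Turns a bound on a supremum over the unit ball into a homogeneous inequality,
to which the identity [mobius_defect_l2norm] applies vector by vector. *)
Lemma opnorm_le (R : realType) (A : 'M[R[i]]_2) (M : R) : 0 <= M ->
  opnorm A <= M <-> forall v, l2norm (A *m v) <= M * l2norm v.
Proof.
move=> M0; split=> [AM v|H].
  have [/l2norm_eq0->|v0] := eqVneq (l2norm v) 0.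
    by rewrite mulmx0 -(scale0r (0 : 'cV[R[i]]_2)) l2normZ normc0 !mul0r mulr0.
  have v_gt0 : 0 < l2norm v by rewrite lt_neqAle eq_sym v0 l2norm_ge0.
  have nv : normc ((l2norm v)^-1)%:C = (l2norm v)^-1.
    by rewrite normc_real ger0_norm// invr_ge0 ltW.
  rewrite -ler_pdivrMr// mulrC -nv -l2normZ scalemxAr.
  apply: le_trans AM; apply: ub_le_sup; first exact: opnorm_set_bounded.
  by exists (((l2norm v)^-1)%:C *: v); rewrite //= l2normZ nv mulVf.
apply: ge_sup.
  exists (l2norm (A *m 0)), 0 => //=.
  by rewrite -(scale0r (0 : 'cV[R[i]]_2)) l2normZ normc0 mul0r.
move=> _ [v /= v1 <-]; rewrite (le_trans (H v))//.
by rewrite -[leRHS]mulr1 ler_wpM2l.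
Qed.

(** * Moebius maps and the reduction to functions vanishing at a point *)

Lemma mobius_defect (R : rcfType) (b n d : R[i]) :
  normc (d - b^* * n) ^+ 2 - normc (n - b * d) ^+ 2 =
  (1 - normc b ^+ 2) * (normc d ^+ 2 - normc n ^+ 2).
Proof.
rewrite !sqr_normcE; case: b n d => [b1 b2] [n1 n2] [d1 d2] /=; ring.
Qed.

Lemma mobius_defect_l2norm (R : realType) k (b : R[i]) (n d : 'cV[R[i]]_k) :
  l2norm (d - b^* *: n) ^+ 2 - l2norm (n - b *: d) ^+ 2 =
  (1 - normc b ^+ 2) * (l2norm d ^+ 2 - l2norm n ^+ 2).
Proof.
rewrite !sqr_l2norm -!sumrB mulr_sumr; apply: eq_bigr => i _.
by rewrite !mxE -mobius_defect.
Qed.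

Lemma mobius_normc_le (R : rcfType) (b n d : R[i]) : normc b < 1 ->
  (normc (n - b * d) <= normc (d - b^* * n)) = (normc n <= normc d).
Proof.
move=> b1; rewrite -[LHS](ler_pXn2r (n := 2)) ?nnegrE ?normc_ge0//.
rewrite -[RHS](ler_pXn2r (n := 2)) ?nnegrE ?normc_ge0//.
rewrite -subr_ge0 mobius_defect pmulr_rge0 ?subr_ge0// subr_gt0.
by rewrite expr_lt1 ?normc_ge0.
Qed.

(** Von Neumann's inequality for the disc automorphism with parameter b, in
fraction-free form: with n = N x and d = D x for matrices N and D, the right side
says that N D^-1 is a contraction, and the left side that its image
(N - b D) (D - b^* N)^-1 under the automorphism is one. *)
Lemma mobius_l2norm_le (R : realType) k (b : R[i]) (n d : 'cV[R[i]]_k) :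
  normc b < 1 ->
  (l2norm (n - b *: d) <= l2norm (d - b^* *: n)) = (l2norm n <= l2norm d).
Proof.
move=> b1; rewrite -[LHS](ler_pXn2r (n := 2)) ?nnegrE ?l2norm_ge0//.
rewrite -[RHS](ler_pXn2r (n := 2)) ?nnegrE ?l2norm_ge0//.
rewrite -subr_ge0 mobius_defect_l2norm pmulr_rge0 ?subr_ge0// subr_gt0.
by rewrite expr_lt1 ?normc_ge0.
Qed.

Lemma rho_mul_den (R : realType) (Omega : set R[i]^o) (A : 'M[R[i]]_2)
    (r : Defs.Rat Omega) : horner_mx A (den r) \is a GRing.unit ->
  rho Omega A r *m horner_mx A (den r) = horner_mx A (Defs.num r).
Proof. by move=> Du; rewrite mulmxE divrK. Qed.

Section Reduction.
Variables (R : realType) (Omega : set R[i]^o) (A : 'M[R[i]]_2) (w0 : R[i]).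
Hypotheses (Omegab : bounded_set Omega) (w0_in : Omega w0).
Hypothesis A_unit : forall r : Defs.Rat Omega, horner_mx A (den r) \is a GRing.unit.

Let Omega0 : Omega !=set0. Proof. by exists w0. Qed.

(** The hypothesis on A says that its eigenvalues are not poles of any function
in Rat(Omega).  The point w0 may be any point of Omega:
where r is normalized to vanish depends on the matrix to which this is applied. *)
Lemma contractive_vanishing :
  contractive (rho Omega A) <->
  forall r : Defs.Rat Omega, rat_norm r <= 1 -> rat_eval r w0 = 0 ->
    opnorm (rho Omega A r) <= 1.
Proof.
split=> [H r r1 _|H r]; first exact: le_trans (H r) r1.
apply/ler_addgt0Pr => e e0; set M := rat_norm r + e.
(* The scaled function n / d has norm at most k < 1 on Omega. *)
have r_ge0 : 0 <= rat_norm r.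
  exact: le_trans (normc_ge0 _) (normc_rat_eval_le Omegab r w0_in).
have M0 : 0 < M by rewrite ltr_wpDl.
pose k := rat_norm r / M.
have k1 : k < 1 by rewrite ltr_pdivrMr// mul1r ltrDl.
pose d := den r.
have [n nE] : {n | n = (M^-1)%:C *: Defs.num r} by eexists.
have d_neq0 w : Omega w -> d.[w] != 0 by move=> /subset_closure; exact: den_neq0.
have n_le w : Omega w -> normc n.[w] <= k * normc d.[w].
  move=> Hw; rewrite nE hornerZ normcM normc_real ger0_norm; last first.
    by rewrite invr_ge0 ltW.
  rewrite mulrC.
  rewrite /k mulrAC ler_pM2r ?invr_gt0// -ler_pdivrMr ?normc_gt0 ?d_neq0//.
  by rewrite -normcV -normcM; exact: normc_rat_eval_le.
pose b := n.[w0] / d.[w0].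
have b1 : normc b < 1.
  rewrite normcM normcV ltr_pdivrMr ?normc_gt0 ?d_neq0// mul1r.
  by rewrite (le_lt_trans (n_le _ w0_in))// gtr_pMl ?normc_gt0 ?d_neq0.
have [delta delta0 d_ge] := horner_bounded_below (@den_neq0 _ _ r).
(* On Omega, |d - b^* n| >= |d| - |n| >= (1 - k) |d|, which stays away from 0. *)
have h_neq0 w : closure Omega w -> (d - b^* *: n).[w] != 0.
  apply: (@horner_neq0_closure _ _ _ ((1 - k) * delta)) w => [|w Hw].
    by rewrite mulr_gt0// subr_gt0.
  rewrite hornerD hornerN hornerZ (le_trans _ (lerB_normc _ _))// normcM normc_conj.
  apply: (@le_trans _ _ ((1 - k) * normc d.[w])).
    by rewrite ler_pM2l ?subr_gt0// d_ge.
  rewrite mulrBl mul1r lerD2l lerN2 (le_trans _ (n_le w Hw))//.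
  by rewrite ler_piMl ?normc_ge0 ?(ltW b1).
pose g := MkRat (n - b *: d) h_neq0.
have g1 : rat_norm g <= 1.
  apply/(rat_norm_le Omega0 Omegab) => w Hw; rewrite /rat_eval normcM normcV.
  have hw := h_neq0 w (subset_closure Hw).
  rewrite ler_pdivrMr ?normc_gt0// mul1r !hornerD !hornerN !hornerZ.
  rewrite mobius_normc_le//.
  by rewrite (le_trans (n_le w Hw))// ler_piMl ?normc_ge0 ?(ltW k1).
have g0 : rat_eval g w0 = 0.
  by rewrite /rat_eval !hornerE /b divfK ?d_neq0// subrr mul0r.
have /(opnorm_le _ ler01) Hg := H g g1 g0.
apply/opnorm_le => [|v]; first exact: ltW.
(* Write v = d(A) x; then g(A) maps (d - b^* n)(A) x to (n - b d)(A) x. *)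
pose x := invmx (horner_mx A d) *m v.
have vE : horner_mx A d *m x = v.
  by rewrite mulmxA mulmxV ?mul1mx//; exact: A_unit.
have := Hg (horner_mx A (den g) *m x).
rewrite mulmxA rho_mul_den ?A_unit// mul1r.
have hE (c : R[i]) (p q : {poly R[i]}) : horner_mx A (p - c *: q) *m x =
    horner_mx A p *m x - c *: (horner_mx A q *m x).
  by rewrite rmorphB /= horner_mxZ mulmxBl scalemxAl.
rewrite !hE mobius_l2norm_le// vE nE horner_mxZ -scalemxAl l2normZ.
rewrite -(rho_mul_den (A_unit r)) -mulmxA vE normc_real.
by rewrite ger0_norm ?invr_ge0 ?(ltW M0)// ler_pdivrMl.
Qed.

End Reduction.

(** * The functional calculus of lower triangular matrices *)

Lemma mul_mx2 (R : realType) (a b c d a' b' c' d' : R[i]) :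
  mx2 a b c d * mx2 a' b' c' d' =
  mx2 (a * a' + b * c') (a * b' + b * d') (c * a' + d * c') (c * b' + d * d').
Proof.
apply/matrixP => i j; rewrite !mxE !big_ord_recl big_ord0 !mxE /= addr0.
by case: (i == ord0); case: (j == ord0).
Qed.

Lemma scalar_mx2 (R : realType) (a : R[i]) : a%:M = mx2 a 0 0 a.
Proof.
by apply/matrixP => [] [[|[|//]] ?] [[|[|//]] ?]; rewrite !mxE.
Qed.

Lemma add_mx2 (R : realType) (a b c d a' b' c' d' : R[i]) :
  mx2 a b c d + mx2 a' b' c' d' = mx2 (a + a') (b + b') (c + c') (d + d').
Proof.
by apply/matrixP => i j; rewrite !mxE; case: (i == ord0); case: (j == ord0).
Qed.

Lemma mx2_lower_unit (R : realType) (a c d : R[i]) :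
  a != 0 -> d != 0 -> mx2 a 0 c d \is a GRing.unit.
Proof.
move=> a0 d0; have [] // := @mulmx1_unit _ _ (mx2 a 0 c d)
  (mx2 a^-1 0 (- (c / a / d)) d^-1).
rewrite mulmxE mul_mx2 scalar_mx2 !mulr0 !mul0r !addr0 !add0r !divff//.
by congr mx2; field; rewrite a0 d0.
Qed.

Lemma horner_matA (R : realType) (z1 z2 mu : R[i]) (s : R) (p : {poly R[i]}) :
  horner_mx (matA z1 z2 mu s) p =
  mx2 p.[z1] 0 (s%:C * mu * (p.[z1] - p.[z2])) p.[z2].
Proof.
elim/poly_ind: p => [|p c IH].
  by rewrite rmorph0 !horner0 subrr mulr0 -scalar_mx2 raddf0.
rewrite rmorphD rmorphM /= horner_mx_X horner_mx_C IH mul_mx2 scalar_mx2 add_mx2.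
by rewrite !hornerMXaddC; congr mx2; ring.
Qed.

Lemma horner_matB (R : realType) (z lambda : R[i]) (t : R) (p : {poly R[i]}) :
  horner_mx (matB z lambda t) p =
  mx2 p.[z] 0 (t%:C * lambda * p^`().[z]) p.[z].
Proof.
elim/poly_ind: p => [|p c IH].
  by rewrite rmorph0 deriv0 !horner0 mulr0 -scalar_mx2 raddf0.
rewrite rmorphD rmorphM /= horner_mx_X horner_mx_C IH mul_mx2 scalar_mx2 add_mx2.
by rewrite derivMXaddC hornerD hornerMX hornerMXaddC; congr mx2; ring.
Qed.

(** Such a matrix has rank at most one, and only the first coordinate of the
argument matters. *)
Lemma opnorm_first_column (R : realType) (a c : R[i]) :
  opnorm (mx2 a 0 c 0) <= 1 <-> normc a ^+ 2 + normc c ^+ 2 <= 1.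
Proof.
have colE (v : 'cV[R[i]]_2) : l2norm (mx2 a 0 c 0 *m v) ^+ 2 =
    (normc a ^+ 2 + normc c ^+ 2) * normc (v ord0 ord0) ^+ 2.
  rewrite sqr_l2norm !big_ord_recl big_ord0 !mxE !big_ord_recl !big_ord0 !mxE /=.
  by rewrite !mul0r !addr0 !normcM !exprMn mulrDl.
split=> [/(opnorm_le _ ler01) H|ac1].
  have := H (delta_mx ord0 ord0).
  rewrite -(ler_pXn2r (n := 2)) ?nnegrE ?mul1r ?l2norm_ge0// colE sqr_l2norm.
  rewrite !big_ord_recl big_ord0 !mxE /= !expr0n !expr1n !addr0 sqrtr1 sqrtr0.
  by rewrite expr0n expr1n !addr0 mulr1.
apply/(opnorm_le _ ler01) => v; rewrite mul1r.
rewrite -(ler_pXn2r (n := 2)) ?nnegrE ?l2norm_ge0// colE.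
apply: le_trans (_ : normc (v ord0 ord0) ^+ 2 <= _).
  by rewrite ler_piMl ?sqr_ge0.
by rewrite ler_pXn2r ?nnegrE ?l2norm_ge0 ?normc_ge0// normc_le_l2norm.
Qed.

(** * Derivatives and extremal values *)

(** At a zero z of r = (w - z) q / den the difference quotient is exactly
q / den, so the derivative is the value at z of this continuous function; the
product rule for num = (w - z) q gives q(z) = num'(z). *)
Lemma derive1_rat_eval_zero (R : realType) (Omega : set R[i]^o)
    (r : Defs.Rat Omega) (z : R[i]) :
  Omega z -> rat_eval r z = 0 ->
  derive1 (rat_eval r) z = (Defs.num r)^`().[z] / (den r).[z].
Proof.
move=> Hz rz0.
have dz0 : (den r).[z] != 0 by apply: den_neq0; exact: subset_closure.
have /factor_theorem[q nE] : root (Defs.num r) z.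
  by apply/rootP; move/eqP: rz0; rewrite mulf_eq0 invr_eq0 (negPf dz0) orbF => /eqP.
have -> : (Defs.num r)^`().[z] = q.[z].
  by rewrite nE derivM derivXsubC !hornerE subrr mulr0 add0r.
pose g (w : R[i]^o) : R[i]^o := q.[w] / (den r).[w].
have g_cont : {for z, continuous g}.
  apply: (@continuousM R[i] R[i]^o); first exact: continuous_horner_complex.
  apply: (@continuousV R[i] R[i]^o (fun w => (den r).[w] : R[i]^o)) => //.
  exact: (@continuous_horner_complex R (den r) z).
rewrite /derive1; apply: cvg_lim; first exact: (@norm_hausdorff R[i] R[i]^o).
apply: (@cvg_trans _ (g (h + z) @[h --> (0 : R[i]^o)^'])).
  apply: near_eq_cvg; near=> h.
  have h0 : h != 0 by near: h; exact: nbhs_dnbhs_neq.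
  rewrite /g rz0 subr0 /rat_eval nE hornerM hornerXsubC addrK.
  rewrite -[RHS]/(h^-1 * _) mulrAC [_ * h]mulrC mulrA mulVf// mul1r.
  by [].
have : g (h + z) @[h --> (0 : R[i]^o)] --> g z.
  apply: (cvg_comp (fun h : R[i]^o => h + (z : R[i]^o)) g _ g_cont).
  pose sh : R[i]^o -> R[i]^o := id + cst (z : R[i]^o).
  have : sh h @[h --> (0 : R[i]^o)] --> sh 0.
    by apply: continuousD; [exact: cvg_id|exact: cst_continuous].
  have zE : sh 0 = z by exact: add0r.
  by rewrite zE.
apply: cvg_trans; apply: cvg_app; exact: cvg_within.
Unshelve. all: by end_near.
Qed.

(** The parameter 1 gives s <= K.  If s < K, the real parameter K / s > 1 would
still satisfy the bound. *)
Lemma scale_threshold (R : realType) (s K : R) : 0 < s ->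
  (forall mu : R[i], s * normc mu <= K <-> normc mu <= 1) <-> s = K.
Proof.
move=> s0; split=> [H|<- mu]; last by rewrite ger_pMr.
have sK : s <= K by have := (H 1).2; rewrite normc1 mulr1; apply.
apply/le_anti; rewrite sK /=; have := (H (K / s)%:C).1.
have Ks0 : 0 <= K / s by rewrite divr_ge0 ?(ltW s0) ?(le_trans (ltW s0)).
rewrite normc_real ger0_norm// mulrC divfK ?gt_eqF// => /(_ (lexx K)).
by rewrite ler_pdivrMr// mul1r.
Qed.

Lemma sup_mul_le1 (R : realType) (E : set R) (c : R) :
  E !=set0 -> has_ubound E -> 0 <= c ->
  (forall x, E x -> x * c <= 1) <-> sup E * c <= 1.
Proof.
move=> E0 Eb; case: ltgtP => // [c0 _|<- _]; last first.
  by rewrite mulr0 ler01; split=> // _ x _; rewrite mulr0 ler01.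
rewrite -ler_pdivlMr//; split=> [H|H x Ex].
  by apply: ge_sup => // x Ex; rewrite ler_pdivlMr// H.
by rewrite -ler_pdivlMr// (le_trans _ H)// ub_le_sup.
Qed.

Section Criteria.
Variables (R : realType) (Omega : set R[i]^o).
Hypothesis Omegab : bounded_set Omega.

(** This function makes both extremal values positive. *)
Lemma exists_vanishing_at (a : R[i]) : Omega a ->
  exists r : Defs.Rat Omega,
    [/\ rat_norm r <= 1, rat_eval r a = 0,
        forall w, w != a -> rat_eval r w != 0 & derive1 (rat_eval r) a != 0].
Proof.
move=> Ha; have Omega0 : Omega !=set0 by exists a.
have [M HM] := bounded_horner ('X - a%:P) Omegab.
have M0 : 0 <= M by rewrite (le_trans _ (HM a Ha))// normc_ge0.
have c_neq0 : (M + 1)%:C != 0.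
  by rewrite -normc_gt0 normc_real normr_gt0 gt_eqF// ltr_wpDl.
have d_neq0 w : closure Omega w -> ((M + 1)%:C%:P : {poly R[i]}).[w] != 0.
  by rewrite hornerC.
pose r := MkRat ('X - a%:P) d_neq0.
have ra : rat_eval r a = 0 by rewrite /rat_eval hornerXsubC subrr mul0r.
exists r; split=> //.
- apply/(rat_norm_le Omega0 Omegab) => w Hw.
  rewrite /rat_eval normcM normcV hornerC normc_real ger0_norm ?addr_ge0//.
  rewrite ler_pdivrMr ?ltr_wpDl// mul1r (le_trans (HM w Hw))//.
  by rewrite lerDl.
- move=> w wa; rewrite /rat_eval hornerXsubC hornerC mulf_neq0 ?invr_eq0//.
  by rewrite subr_eq0.
- rewrite derive1_rat_eval_zero//= derivXsubC !hornerC.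
  by rewrite mulf_neq0 ?oner_eq0 ?invr_eq0.
Qed.

Lemma contractive_matA (z1 z2 mu : R[i]) (s : R) :
  Omega z1 -> Omega z2 -> 0 <= s ->
  contractive (rho Omega (matA z1 z2 mu s)) <->
  forall r : Defs.Rat Omega, rat_norm r <= 1 -> rat_eval r z2 = 0 ->
    normc (rat_eval r z1) ^+ 2 * (1 + (s * normc mu) ^+ 2) <= 1.
Proof.
move=> Hz1 Hz2 s0.
have Dn (r : Defs.Rat Omega) w : Omega w -> (den r).[w] != 0.
  by move=> /subset_closure; exact: den_neq0.
have A_unit (r : Defs.Rat Omega) :
    horner_mx (matA z1 z2 mu s) (den r) \is a GRing.unit.
  by rewrite horner_matA mx2_lower_unit ?Dn.
rewrite (contractive_vanishing Omegab Hz2 A_unit).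
suff rhoE r : rat_eval r z2 = 0 -> rho Omega (matA z1 z2 mu s) r =
    mx2 (rat_eval r z1) 0 (s%:C * mu * rat_eval r z1) 0.
  have sumE (x : R) :
      x ^+ 2 + (s * normc mu * x) ^+ 2 = x ^+ 2 * (1 + (s * normc mu) ^+ 2).
    by ring.
  split=> H r r1 rz2; have := H r r1 rz2; rewrite rhoE// opnorm_first_column;
  by rewrite (normcM _ (rat_eval r z1)) (normcM s%:C) normc_real ger0_norm// sumE.
move=> rz2; have nz2 : (Defs.num r).[z2] = 0.
  by move/eqP: rz2; rewrite mulf_eq0 invr_eq0 (negPf (Dn _ _ Hz2)) orbF => /eqP.
apply: (mulIr (A_unit r)); rewrite /rho divrK// !horner_matA mul_mx2 nz2.
by rewrite /rat_eval; congr mx2; field; rewrite ?Dn.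
Qed.

Lemma contractive_matB (z lambda : R[i]) (t : R) :
  Omega z -> 0 <= t ->
  contractive (rho Omega (matB z lambda t)) <->
  forall r : Defs.Rat Omega, rat_norm r <= 1 -> rat_eval r z = 0 ->
    normc (derive1 (rat_eval r) z) * (t * normc lambda) <= 1.
Proof.
move=> Hz t0.
have Dz (r : Defs.Rat Omega) : (den r).[z] != 0.
  by apply: den_neq0; exact: subset_closure.
have B_unit (r : Defs.Rat Omega) :
    horner_mx (matB z lambda t) (den r) \is a GRing.unit.
  by rewrite horner_matB mx2_lower_unit.
rewrite (contractive_vanishing Omegab Hz B_unit).
suff rhoE r : rat_eval r z = 0 -> rho Omega (matB z lambda t) r =
    mx2 0 0 (t%:C * lambda * derive1 (rat_eval r) z) 0.
  split=> H r r1 rz; have := H r r1 rz; rewrite rhoE// opnorm_first_column;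
  rewrite !normcM normc0 normc_real ger0_norm// expr0n add0r;
  by rewrite expr_le1 ?mulr_ge0 ?normc_ge0// mulrC.
move=> rz; rewrite derive1_rat_eval_zero//.
have nz : (Defs.num r).[z] = 0.
  by move/eqP: rz; rewrite mulf_eq0 invr_eq0 (negPf (Dz _)) orbF => /eqP.
apply: (mulIr (B_unit r)); rewrite /rho divrK// !horner_matB mul_mx2 nz.
by congr mx2; field; rewrite ?Dz.
Qed.

End Criteria.

(** * The two criteria *)

Unset Implicit Arguments.
Set Strict Implicit.

Theorem lemma4 (R : realType) (Omega : set R[i]^o) (z1 z2 z : R[i]) (s t : R)
    (hOmega : analytic_domain Omega)
    (hz1 : Omega z1) (hz2 : Omega z2) (hz12 : z1 != z2) (hz : Omega z)
    (hs : 0 < s) (ht : 0 < t) :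
  ((forall mu : R[i],
      contractive (rho Omega (matA z1 z2 mu s)) <-> normc mu <= 1)
   <-> s ^+ 2 = (s_ext Omega z1 z2)^-1 - 1)
  /\
  ((forall lambda : R[i],
      contractive (rho Omega (matB z lambda t)) <-> normc lambda <= 1)
   <-> t = (t_ext Omega z)^-1).
Proof.
have [_ _ Omegab _ _] := hOmega; split.
  set E := [set normc (rat_eval r z1) ^+ 2 |
            r in [set r : Defs.Rat Omega | rat_norm r <= 1 /\ rat_eval r z2 = 0]].
  have [r0 [r01 r0z2 r0z1 _]] := exists_vanishing_at Omegab hz2.
  have Er0 : E (normc (rat_eval r0 z1) ^+ 2) by exists r0.
  have E0 : E !=set0 by exists (normc (rat_eval r0 z1) ^+ 2).
  have E1 : ubound E 1.
    move=> _ [r [r1 _] <-]; rewrite expr_le1 ?normc_ge0//.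
    exact: le_trans (normc_rat_eval_le Omegab r hz1) r1.
  have Eb : has_ubound E by exists 1.
  have S_gt0 : 0 < s_ext Omega z1 z2.
    apply: lt_le_trans (ub_le_sup Eb Er0).
    by rewrite exprn_gt0// normc_gt0 r0z1.
  have S_le1 : s_ext Omega z1 z2 <= 1 by exact: ge_sup.
  set K := (s_ext Omega z1 z2)^-1 - 1.
  have K_ge0 : 0 <= K by rewrite subr_ge0 invf_ge1.
  have crit mu : contractive (rho Omega (matA z1 z2 mu s)) <->
      s * normc mu <= Num.sqrt K.
    rewrite (contractive_matA Omegab)//; last exact: ltW.
    rewrite -(ler_pXn2r (n := 2)) ?nnegrE ?sqrtr_ge0//; last first.
      by rewrite mulr_ge0 ?normc_ge0// ltW.
    rewrite sqr_sqrtr// lerBrDl -(mul1r (s_ext Omega z1 z2)^-1).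
    rewrite ler_pdivlMr// (mulrC (1 + _)).
    rewrite -(sup_mul_le1 E0 Eb) ?addr_ge0 ?sqr_ge0//.
    split=> [H _ [r [r1 r0'] <-]|H r r1 r0']; first exact: H.
    by apply: H; exists r.
  have -> : (forall mu, contractive (rho Omega (matA z1 z2 mu s)) <->
      normc mu <= 1) <-> s = Num.sqrt K.
    by rewrite -scale_threshold//; split=> H mu; have := H mu; rewrite crit.
  split=> [->|<-]; first by rewrite sqr_sqrtr.
  by rewrite sqrtr_sqr ger0_norm// ltW.
set E := [set normc (derive1 (rat_eval r) z) |
          r in [set r : Defs.Rat Omega | rat_norm r <= 1 /\ rat_eval r z = 0]].
have crit lambda : contractive (rho Omega (matB z lambda t)) <->
    forall x, E x -> x * (t * normc lambda) <= 1.
  rewrite (contractive_matB Omegab)//; last exact: ltW.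
  split=> [H _ [r [r1 r0] <-]|H r r1 r0]; first exact: H.
  by apply: H; exists r.
have [r0 [r01 r0z _ r0']] := exists_vanishing_at Omegab hz.
have Er0 : E (normc (derive1 (rat_eval r0) z)) by exists r0.
have E0 : E !=set0 by exists (normc (derive1 (rat_eval r0) z)).
have [Eb|Eunb] := pselect (has_ubound E); last first.
  (* Here [sup] takes its default value 0, and both sides are false. *)
  have -> : t_ext Omega z = 0 by apply: sup_out => -[].
  rewrite invr0; split=> [H|t0]; last by move: ht; rewrite t0 ltxx.
  case: Eunb; exists t^-1 => x Ex.
  have := (crit 1).1 ((H 1).2 _) x Ex.
  by rewrite normc1 lexx mulr1 => /(_ isT); rewrite -ler_pdivlMr ?div1r.
have T_gt0 : 0 < t_ext Omega z.
  by apply: lt_le_trans (ub_le_sup Eb Er0); rewrite normc_gt0.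
have {}crit lambda : contractive (rho Omega (matB z lambda t)) <->
    t * normc lambda <= (t_ext Omega z)^-1.
  rewrite crit (sup_mul_le1 E0 Eb) ?mulr_ge0 ?normc_ge0 ?(ltW ht)//.
  by rewrite -(mul1r (t_ext Omega z)^-1) ler_pdivlMr// mulrC.
by rewrite -scale_threshold//; split=> H lambda; have := H lambda; rewrite crit.
Qed.
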